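(* Let $R$ be an uncountable range set, and let $(X,d)$ and $(Y,e)$ be $R$-petaloid ultrametric spaces with $R$-petals $\{\Pi(X,S)\}_{S\in\mathrm{TEN}(R)}$ and $\{\Pi(Y,S)\}_{S\in\mathrm{TEN}(R)}$. Let $f:\Pi(X,S)\to\Pi(Y,S)$ be an isometric bijection, where $S\in\mathrm{TEN}(R)$. Then there exists an isometric bijection $F:X\to Y$ such that $F|_{\Pi(X,S)}=f$.
   Context: A range set is a subset $R\subseteq[0,\infty)$ with $0\in R$. An ultrametric is a metric $d$ with $d(x,y)\le \max\{d(x,z),d(z,y)\}$ for all $x,y,z$. An ultrametric $d$ on a set $X$ is $R$-valued (an $R$-ultrametric) if $d(x,y)\in R$ for all $x,y\in X$. A subset $E\subseteq[0,\infty)$ is semi-sporadic if there is a strictly decreasing sequence $\{a_i\}_{i\in\mathbb{Z}_{\ge 0}}$ in $(0,\infty)$ with $\lim_{i\to\infty} a_i=0$ and $E=\{0\}\cup\{a_i\mid i\in\mathbb{Z}_{\ge0}\}$. A subset of $[0,\infty)$ is tenuous if it is finite or semi-sporadic. $\mathrm{TEN}(R)$ denotes the set of all tenuous subsets $S\subseteq R$ with $0\in S$. For a metric space $(X,d)$, $x\in X$ and $A\subseteq X$, put $d(x,A)=\inf_{a\in A}d(x,a)$; restrictions of a metric to subsets are denoted by the same symbol. For a range set $S$, $\mathscr{N}(S)$ is the class of all finite $S$-valued ultrametric spaces. For a class $\mathscr{C}$ of metric spaces, a metric space $(X,d)$ is $\mathscr{C}$-injective if for all $(A,a),(B,b)\in\mathscr{C}$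 and all isometric embeddings $\phi:(A,a)\to(B,b)$, $\psi:(A,a)\to(X,d)$ there is an isometric embedding $\theta:(B,b)\to(X,d)$ with $\theta\circ\phi=\psi$. For a countable (possibly finite) range set $S$, the $S$-Urysohn universal ultrametric space is the non-empty separable complete $\mathscr{N}(S)$-injective $S$-valued ultrametric space, which is unique up to isometry. For an uncountable range set $R$, a metric space $(X,d)$ is $R$-petaloid if it is an $R$-valued ultrametric space and there is a family $\{\Pi(X,S)\}_{S\in\mathrm{TEN}(R)}$ of subspaces of $X$ (called an $R$-petal of $X$) such that: (P1) for every $S\in\mathrm{TEN}(R)$, $(\Pi(X,S),d)$ is isometric to the $S$-Urysohn universal ultrametric space; (P2) $\bigcup_{S\in\mathrm{TEN}(R)}\Pi(X,S)=X$; (P3) $\Pi(X,S)\cap\Pi(X,T)=\Pi(X,S\cap T)$ for all $S,T\in\mathrm{TEN}(R)$; (P4) if $S,T\in\mathrm{TEN}(R)$ and $x\in\Pi(X,T)$, then $d(x,\Pi(X,S))\in(T\setminus S)\cup\{0\}$. *)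

(* Defs.v *)
(* The reals are an arbitrary K : realType; a metricType K may be empty. *)
From HB Require Import structures.
From mathcomp Require Import all_boot all_order all_algebra.
From mathcomp Require Import all_classical all_reals all_analysis.

Set Implicit Arguments.
Unset Strict Implicit.
Unset Printing Implicit Defensive.

Import Order.TTheory GRing.Theory Num.Theory.
Import numFieldNormedType.Exports.

Local Open Scope classical_set_scope.
Local Open Scope ring_scope.

Definition range_set (K : realType) (R : set K) : Prop :=
  R `<=` [set r | 0 <= r] /\ R 0.

(* [decreasing_seq] is strict: n <= m if and only if a m <= a n. *)
Definition semi_sporadic (K : realType) (E : set K) : Prop :=
  exists a : nat -> K,
    [/\ decreasing_seq a, forall n, 0 < a n, a n @[n --> \oo] --> (0 : K)
      & E = [set 0] `|` range a].

Definition tenuous (K : realType) (E : set K) : Prop :=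
  E `<=` [set r | 0 <= r] /\ (finite_set E \/ semi_sporadic E).

Definition TEN (K : realType) (R : set K) : set (set K) :=
  [set S | [/\ tenuous S, S `<=` R & S 0]].

Definition ultrametric (K : realType) (X : metricType K) : Prop :=
  forall x y z : X, mdist x y <= Num.max (mdist x z) (mdist z y).

Definition valued_in (K : realType) (R : set K) (X : metricType K) : Prop :=
  forall x y : X, R (mdist x y).

Definition dist_to_set (K : realType) (X : metricType K) (x : X) (A : set X) : K :=
  inf [set mdist x a | a in A].

Definition isometric_on (K : realType) (X Y : metricType K) (A : set X)
    (f : X -> Y) : Prop :=
  forall x y, A x -> A y -> mdist (f x) (f y) = mdist x y.

(* Isometric embeddings; injectivity follows from preservation of distances. *)
Definition isometric (K : realType) (X Y : metricType K) (f : X -> Y) : Prop :=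
  isometric_on [set: X] f.

Definition finite_ultrametric_spaces (K : realType) (S : set K)
    (A : metricType K) : Prop :=
  [/\ finite_set [set: A], ultrametric A & valued_in S A].

Definition injective_for (K : realType) (C : metricType K -> Prop)
    (X : metricType K) : Prop :=
  forall (A B : metricType K), C A -> C B ->
  forall (phi : A -> B) (psi : A -> X), isometric phi -> isometric psi ->
  exists theta : B -> X, isometric theta /\ theta \o phi = psi.

Definition separable_space (T : topologicalType) : Prop :=
  exists D : set T, countable D /\ dense D.

Definition complete_space (T : uniformType) : Prop :=
  forall F : set_system T, ProperFilter F -> cauchy F -> exists x : T, F --> x.

(* For countable S this determines U up to isometry. *)
Definition urysohn_universal (K : realType) (S : set K) (U : metricType K) : Prop :=
  [/\ [set: U] !=set0, separable_space U, complete_space U,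
      injective_for (finite_ultrametric_spaces S) U
    & ultrametric U /\ valued_in S U].

Definition subspace_isometric_to (K : realType) (X : metricType K) (A : set X)
    (U : metricType K) : Prop :=
  exists g : X -> U, set_bij A [set: U] g /\ isometric_on A g.

(* Only the members of Pi indexed by TEN R are relevant. *)
Definition is_petal (K : realType) (R : set K) (X : metricType K)
    (Pi : set K -> set X) : Prop :=
  [/\ forall S, TEN R S ->
        exists U : metricType K,
          urysohn_universal S U /\ subspace_isometric_to (Pi S) U,
      \bigcup_(S in TEN R) Pi S = [set: X],
      forall S T, TEN R S -> TEN R T -> Pi S `&` Pi T = Pi (S `&` T)
    & forall S T x, TEN R S -> TEN R T -> Pi T x ->
        ((T `\` S) `|` [set 0]) (dist_to_set x (Pi S))].

Definition petaloid (K : realType) (R : set K) (X : metricType K) : Prop :=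
  [/\ ultrametric X, valued_in R X & exists Pi : set K -> set X, is_petal R Pi].

(* Main.v *)
Require Import Defs.
From HB Require Import structures.
From mathcomp Require Import all_boot all_order all_algebra.
From mathcomp Require Import finmap.
From mathcomp Require Import all_classical all_reals all_analysis.

Set Implicit Arguments.
Unset Strict Implicit.
Unset Printing Implicit Defensive.

Import Order.TTheory GRing.Theory Num.Theory.

Local Open Scope classical_set_scope.
Local Open Scope ring_scope.

(** The isometry is first built on the petals over the finite enlargements of
    [S], that is over the [T] containing [S] with [T \ S] finite, and then
    extended by completeness.  It cannot be built on smaller petals, because [f]
    need not respect them.

    Zorn's lemma is applied to the partial isometries [G] from [X] to [Y] that
    extend [f] and whose domain is a union of petals over finite enlargements,
    downward closed, each carried onto the petal of [Y] with the same index.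
    If some finite enlargement is not reached by a maximal [G], take [T] minimal
    with this property.  Then [G] is defined exactly on the part [A] of [Pi T]
    made of the smaller petals [Pi (T \ {t})], [t] in [T \ S]
    ([petal_skeleton]), and two things have to be done.

    First, the restriction of [G] to [A] is extended to an isometry from [Pi T]
    onto its counterpart, by a back-and-forth along dense sequences.  A partial
    isometry of a Urysohn space need not extend, since its range may already
    meet every ball available to the new point.  Here it never does: by the axiom
    on distances to a petal, a point of [Pi T] outside [Pi (T \ {t})] is at
    distance exactly [t] from it, so that with [r] the least element of [T \ S]
    every point outside [A] is at distance exactly [r] from [A], and within distance [r] of
    a well-chosen nearest point, [A] fills a single open ball of radius [r]
    ([skeleton_spared], [back_and_forth]).

    Secondly, the extension must be isometric together with the rest of [G]
    ([compatible_carries]).  If [x] lies in [Pi T] and [z] in [Pi I], go from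
    [x] to a nearest point [p] of [Pi (T /\ I)], then to a nearest point [q] of
    [z] there, then to [z].  Unless [x] or [z] lies in [Pi (T /\ I)], where the
    two isometries agree, the distance axiom puts the three lengths in the
    disjoint sets [T \ I], [T /\ I] and [I \ T], so that [d(x, z)] is the
    largest of them, and each of the three is preserved.

    Hence a maximal [G] carries all the petals over finite enlargements.  Any
    point of [X] lies in a petal over some [J] containing [S], and by the same
    axiom it is within [e] of the petal over the finite enlargement of [S] by the
    elements of [J] that are at least [e].  So the domain of [G] is dense, and since each
    petal is complete the closure of [G] is the graph of the required
    isometry. *)

(** * Tenuous sets *)

Lemma finite_set_argmin (K : realType) (T : choiceType) (A : set T) (h : T -> K) :
  finite_set A -> A !=set0 -> exists2 m, A m & forall x, A x -> h m <= h x.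
Proof.
move=> /finite_seqP[s ->]; elim: s => [[x]//|a s IH _].
case: s IH => [_|b s /(_ (ex_intro _ b _)) IH].
  by exists a => /= [|x]; rewrite ?inE // => /eqP ->.
have [|m ms mmin] := IH; first by rewrite /= inE eqxx.
have [le_am|lt_ma] := leP (h a) (h m).
  exists a => [|x]; rewrite /= inE ?eqxx // => /orP[/eqP -> //|xs].
  exact: le_trans (mmin x xs).
exists m => [|x]; first by rewrite /= inE; apply/orP; right.
by rewrite /= inE => /orP[/eqP ->|]; [exact: ltW|exact: mmin].
Qed.

(** With [finite_ge_tenuous], this characterizes the tenuous sets containing [0]
    by a condition that visibly passes to subsets and to unions. *)
Lemma tenuous_finite_ge (K : realType) (E : set K) (e : K) :
  tenuous E -> 0 < e -> finite_set (E `&` [set t | e <= t]).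
Proof.
move=> [_ [fE|[a [adec apos a0 ->]]]] e0; first exact: finite_setIl.
have /cvgrPdist_lt/(_ e e0)[N _ aN] := a0.
apply: (@sub_finite_set _ _ (a @` `I_N)); last exact/finite_image/finite_II.
move=> t [[->|[n _ <-]] /= et]; first by move: e0; rewrite ltNge et.
exists n => //=; rewrite ltnNge; apply/negP => /aN /=.
by rewrite sub0r normrN gtr0_norm // ltNge et.
Qed.

(** If [E] is infinite, below any [c > 0] it has a positive element, hence a
    largest one, because only finitely many elements exceed a given one.
    Iterating from a bound of [E] lists all positive elements decreasingly. *)
Lemma finite_ge_tenuous (K : realType) (E : set K) :
  E `<=` [set r | 0 <= r] -> E 0 ->
  (forall e, 0 < e -> finite_set (E `&` [set t | e <= t])) -> tenuous E.
Proof.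
move=> E0 E00 fin; split=> //; have [fE|iE] := pselect (finite_set E); first by left.
right.
have next (c : K) : 0 < c -> exists m, [/\ E m, 0 < m, m < c &
    forall t, E t -> t < c -> t <= m].
  move=> c0; have [[e [Ee e0 ec]]|none] := pselect (exists e, [/\ E e, 0 < e & e < c]).
    have fA : finite_set ((E `&` [set t | e <= t]) `&` [set t | t < c]).
      exact: finite_setIl (fin e e0).
    have [|m [[Em em] mc] mmin] := finite_set_argmin (fun t => - t) fA.
      by exists e; do !split => /=.
    exists m; split => //; first exact: lt_le_trans em.
    move=> t Et tc; have [et|te] := leP e t; last exact: le_trans (ltW te) em.
    by rewrite -lerN2; apply: mmin; do !split.
  case: iE; apply: (@sub_finite_set _ _ ([set 0] `|` (E `&` [set t | c <= t]))).
    move=> t Et; have [ct|tc] := leP c t; first by right.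
    left; apply/eqP; rewrite eq_le (E0 _ Et) andbT leNgt; apply/negP => t0.
    by apply: none; exists t.
  by rewrite finite_setU; split; [exact: finite_set1|exact: fin].
have [M M0 EM] : exists2 M, 0 < M & forall t, E t -> t < M.
  have [[b Eb]|none] := pselect (E `&` [set t | 1 <= t] !=set0).
    have [|m [Em m1] mmin] := finite_set_argmin (fun t => - t) (fin _ ltr01).
      by exists b.
    exists (m + 1) => [|t Et]; first by rewrite ltr_wpDl // (le_trans ler01).
    have [t1|t1] := leP 1 t.
      by rewrite (@le_lt_trans _ _ m) ?ltrDl // -lerN2; apply: mmin.
    by rewrite (lt_le_trans t1) // lerDr (le_trans ler01).
  exists 1 => // t Et; rewrite ltNge; apply/negP => t1.
  by apply: none; exists t.
have /choice[g gP] : forall c : K, exists m, 0 < c -> [/\ E m, 0 < m, m < c &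
    forall t, E t -> t < c -> t <= m].
  move=> c; have [c0|c0] := ltP 0 c; last by exists 0.
  by have [m] := next c c0; exists m.
pose a n := iter n.+1 g M.
have apos n : 0 < a n.
  by elim: n => [|n IH]; [case: (gP M M0)|case: (gP (a n) IH)].
have Ea n : E (a n) by case: n => [|n]; [case: (gP M M0)|case: (gP _ (apos n))].
have adec : decreasing_seq a.
  by apply/decreasing_seqP => n; case: (gP _ (apos n)).
have small e : 0 < e -> exists n, a n < e.
  move=> e0; apply: contrapT => none; apply: infinite_nat.
  have ainj : injective a.
    by move=> m n amn; apply/eqP; rewrite eqn_leq -!adec amn lexx.
  have := finite_preimage (f := a) (in2W ainj) (fin e e0).
  apply: sub_finite_set => n _; split; first exact: Ea.
  by rewrite /= leNgt; apply/negP => ane; apply: none; exists n.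
exists a; split => //.
  apply/cvgrPdist_lt => e e0; have [N aN] := small e e0.
  exists N => // n /= Nn; rewrite sub0r normrN gtr0_norm //.
  by apply: le_lt_trans aN; rewrite adec.
apply/seteqP; split => t; last by move=> [->|[n _ <-]].
move=> Et; have [->|t0] := eqVneq t 0; first by left.
right; apply: contrapT => tNa.
have tpos : 0 < t by rewrite lt_neqAle eq_sym t0 E0.
have lt_ta n : t < a n.
  elim: n => [|n IH]; rewrite lt_neqAle.
    case: (gP M M0) => _ _ _ ->; rewrite ?andbT //; last exact: EM.
    by apply/eqP => ta; apply: tNa; exists 0%N.
  case: (gP _ (apos n)) => _ _ _ -> //; rewrite andbT.
  by apply/eqP => ta; apply: tNa; exists n.+1.
by have [n /lt_trans/(_ (lt_ta n))] := small t tpos; rewrite ltxx.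
Qed.

Lemma TEN_sub (K : realType) (R S T : set K) :
  TEN R T -> S `<=` T -> S 0 -> TEN R S.
Proof.
move=> [Tt TR T0] ST S0; split=> //; last exact: subset_trans TR.
apply: finite_ge_tenuous => // [t /ST|e e0]; first by case: Tt => + _; apply.
by apply: sub_finite_set (tenuous_finite_ge Tt e0); exact: setSI.
Qed.

Lemma TEN_setU (K : realType) (R S T : set K) :
  TEN R S -> TEN R T -> TEN R (S `|` T).
Proof.
move=> [St SR S0] [Tt TR T0]; split; [|by rewrite subUset|by left].
apply: finite_ge_tenuous => [t [/(proj1 St)|/(proj1 Tt)]//||e e0]; first by left.
by rewrite setIUl finite_setU; split; exact: tenuous_finite_ge.
Qed.

(** * Urysohn universal spaces *)

Record ultradist (K : realType) (T : Type) (d : T -> T -> K) : Prop := Ultradist {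
  ultradistxx : forall x, d x x = 0;
  ultradist_eq : forall x y, d x y = 0 -> x = y;
  ultradist_sym : forall x y, d x y = d y x;
  ultradist_max : forall y x z, d x z <= Num.max (d x y) (d y z) }.

(** A fresh carrier, so that the metric structure put on it cannot clash with one
    that [T] may already have. *)
Definition ultradist_space (K : realType) (T : choiceType) (d : T -> T -> K)
  (_ : ultradist d) : Type := T.

Section ultradist_space.
Variables (K : realType) (T : choiceType) (d : T -> T -> K) (dP : ultradist d).

Let ge0 x y : 0 <= d x y.
Proof.
by have := ultradist_max dP y x x; rewrite (ultradistxx dP) (ultradist_sym dP y) maxxx.
Qed.

Let triangle y x z : d x z <= d x y + d y z.
Proof.
apply: le_trans (ultradist_max dP y x z) _.
by rewrite ge_max lerDl lerDr !ge0.
Qed.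

HB.instance Definition _ := Choice.on (ultradist_space dP).
HB.instance Definition _ := isMetric.Build K (ultradist_space dP)
  (ultradistxx dP) (ultradist_eq dP) (ultradist_sym dP) triangle.

Lemma ultradist_space_finite (S : set K) : finite_set [set: T] ->
  (forall x y, S (d x y)) ->
  finite_ultrametric_spaces S (ultradist_space dP : metricType K).
Proof. by move=> finT Sd; split=> // x y z; exact: (ultradist_max dP). Qed.

End ultradist_space.

Section urysohn_facts.
Variables (K : realType) (S : set K) (U : metricType K).

Lemma ultrametric_ultradist (T : Type) (h : T -> U) :
  ultrametric U -> injective h -> ultradist (fun a b => mdist (h a) (h b)).
Proof.
move=> um hinj; split=> [a|a b /mdist_positivity/hinj//|a b|b a c] //.
- exact: mdistxx.
- exact: metric_sym.
Qed.

(** The one-point extension of the finite space [A] in which the new point is at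
    distance [max r (d b a)] from [a] is ultrametric; injectivity realizes it.
    This is the only use made of injectivity: the new point lies on the sphere of
    radius [r] around [b], and outside the open balls of radius [r] around the
    points of [A]. *)
Lemma injective_one_point (A : set U) (b : U) (r : K) :
  ultrametric U -> valued_in S U ->
  injective_for (finite_ultrametric_spaces S) U ->
  finite_set A -> A b -> 0 < r -> S r ->
  exists2 y, mdist y b = r & forall a, A a -> r <= mdist y a.
Proof.
move=> um SU inj fA Ab r0 Sr.
pose dA (a a' : A) := mdist (val a) (val a').
have dAP : ultradist dA := ultrametric_ultradist um val_inj.
(* distance from the new point *)
pose far (a : A) := Num.max r (mdist b (val a)).
have far0 a : 0 < far a by rewrite lt_max r0.
pose dB (p q : option A) := match p, q with
  | None, None => 0
  | Some a, None | None, Some a => far a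
  | Some a, Some a' => dA a a' end.
have dBP : ultradist dB.
  split=> [[a|]|[a|] [a'|]|[a|] [a'|]|[c|] [a|] [a'|]] //=; rewrite /dA.
  - exact: mdistxx.
  - by move=> /mdist_positivity/val_inj ->.
  - by move=> /eqP; rewrite gt_eqF.
  - by move=> /eqP; rewrite gt_eqF.
  - exact: metric_sym.
  - exact: um.
  - rewrite /far ge_max !le_max lexx ?orbT /=.
    have := um b (val a) (val c); rewrite (metric_sym (val c)) le_max.
    by move=> /orP[]->; rewrite ?orbT.
  - rewrite /far ge_max !le_max lexx ?orbT /=.
    by have := um b (val a') (val c); rewrite le_max => /orP[]->; rewrite ?orbT.
  - by rewrite le_max ltW.
  - have := um (val a) (val a') b.
    by rewrite !le_max !(metric_sym _ b) => /orP[]->; rewrite ?orbT.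
  - by rewrite le_max lexx.
  - by rewrite le_max lexx orbT.
have finA : finite_set [set: A] by rewrite (eq_finite_set (card_setT A)).
have finB : finite_set [set: option A].
  apply: (@sub_finite_set _ _ ([set None] `|` Some @` [set: A])).
    by move=> [a|] _; [right; exists a|left].
  by rewrite finite_setU; split; [exact: finite_set1|exact: finite_image].
have SA a a' : S (dA a a') by exact: SU.
have SB p q : S (dB p q).
  have Sfar a : S (far a) by rewrite /far; case: leP.
  case: p q => [a|] [a'|] //=.
  by rewrite -(mdistxx b).
have [theta [thetaP thetaE]] := inj _ _ (ultradist_space_finite dAP finA SA)
  (ultradist_space_finite dBP finB SB) (fun a => Some a) (fun a => val a)
  (fun _ _ _ _ => erefl) (fun _ _ _ _ => erefl).
have dtheta (a : A) : mdist (theta None) (val a) = far a.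
  by rewrite -(congr1 (@^~ a) thetaE); exact: thetaP.
exists (theta None) => [|a Aa].
  by rewrite (dtheta (exist _ b (mem_set Ab))) /far /= mdistxx max_l // ltW.
by rewrite (dtheta (exist _ a (mem_set Aa))) le_max lexx.
Qed.

(** Fixing the rate of convergence spares choosing subsequences later. *)
Lemma complete_cauchy_seq (v : nat -> U) : complete_space U ->
  (forall m n, (m <= n)%N -> mdist (v m) (v n) <= m.+1%:R^-1) ->
  exists l, forall n, mdist (v n) l <= n.+1%:R^-1.
Proof.
move=> cU vC; have [|l vl] := cU (v @ \oo) _.
  apply/cauchyP => e e0.
  have [N _ Ne] := near_infty_natSinv_lt (PosNum e0).
  exists (v N), N => // n /= Nn; rewrite ballEmdist /=.
  exact: le_lt_trans (vC _ _ Nn) (Ne N (leqnn N)).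
exists l => n; apply/ler_addgt0Pr => e e0.
have /metricType_numDomainType.cvgrPdist_lt/(_ e e0)[N _ Ne] := vl.
rewrite (le_trans (metric_triangle _ (v (maxn n N)) _)) // lerD //.
  exact/vC/leq_maxl.
by rewrite metric_sym ltW //; apply: Ne; exact: leq_maxr.
Qed.

Lemma dense_seq : [set: U] !=set0 -> separable_space U ->
  exists u : nat -> U, forall x e, 0 < e -> exists n, mdist x (u n) < e.
Proof.
move=> [x0 _] [D [cD dD]].
have D0 : D !=set0.
  by have [x [_ Dx]] := dD setT (ex_intro _ x0 I) openT; exists x.
have /pfcard_geP[D00|[u]] := cD; first by case: D0 => x; rewrite D00.
exists u => x e e0.
have [||y [xy Dy]] := dD (ball x e)^°.
- by exists x; apply: nbhsx_ballx.
- exact: open_interior.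
have [n _ ny] := 'surj_u Dy; exists n; rewrite ny.
by have /= := interior_subset xy; rewrite ballEmdist.
Qed.

End urysohn_facts.

(** What the proof uses of a petal, stated inside the ambient space so that
    no isometry with an abstract Urysohn space needs to be carried around. *)
Record urysohn_subset (K : realType) (S : set K) (X : metricType K)
    (D : set X) : Prop := UrysohnSubset {
  us_valued : forall x y, D x -> D y -> S (mdist x y);
  us_dense : exists2 u : nat -> X, forall n, D (u n) &
    forall x e, D x -> 0 < e -> exists n, mdist x (u n) < e;
  us_complete : forall v : nat -> X, (forall n, D (v n)) ->
    (forall m n, (m <= n)%N -> mdist (v m) (v n) <= m.+1%:R^-1) ->
    exists2 l, D l & forall n, mdist (v n) l <= n.+1%:R^-1;
  us_spread : forall (A : set X) (b : X) (r : K), finite_set A -> A `<=` D ->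
    A b -> 0 < r -> S r ->
    exists y, [/\ D y, mdist y b = r & forall a, A a -> r <= mdist y a] }.

Lemma urysohn_universal_subset (K : realType) (S : set K) (X U : metricType K)
    (D : set X) :
  urysohn_universal S U -> subspace_isometric_to D U -> urysohn_subset S D.
Proof.
move=> [U0 sepU cU injU [umU SU]] [g [gbij giso]].
have [ginv ginvP] : exists h : U -> X, forall u, D (h u) /\ g (h u) = u.
  have /choice[h hP] : forall u, exists x, D x /\ g x = u.
    by move=> u; have [x Dx <-] := set_bij_surj gbij (I : [set: U] u); exists x.
  by exists h.
have Dh u : D (ginv u) by case: (ginvP u).
have gh u : g (ginv u) = u by case: (ginvP u).
have hd u v : mdist (ginv u) (ginv v) = mdist u v by rewrite -giso // !gh.
have hg x : D x -> ginv (g x) = x.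
  by move=> Dx; apply: mdist_positivity; rewrite -giso // gh mdistxx.
split.
- by move=> x y Dx Dy; rewrite -giso.
- have [u ud] := dense_seq U0 sepU.
  exists (ginv \o u) => [n|x e Dx e0] /=; first exact: Dh.
  by have [n un] := ud (g x) e e0; exists n; rewrite -giso // gh.
- move=> v Dv vC; have [|l vl] := complete_cauchy_seq (v := g \o v) cU.
    by move=> m n mn /=; rewrite giso; first exact: vC.
  by exists (ginv l) => [//|n]; rewrite -(hg (v n)) // hd; exact: vl.
- move=> A b r fA AD Ab r0 Sr.
  have [||y yb yA] := injective_one_point (A := g @` A) (b := g b)
    umU SU injU _ _ r0 Sr.
  + exact: finite_image.
  + by exists b.
  exists (ginv y); split=> // [|a Aa]; first by rewrite -(hg b) ?hd //; exact: AD.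
  by rewrite -(hg a) ?hd; [apply: yA; exists a|exact: AD].
Qed.

(** * Ultrametric geometry *)

Section ultrametric_facts.
Variables (K : realType) (X : metricType K).
Hypothesis um : ultrametric X.
Implicit Types (x y z : X).

Lemma ultra_le x y z (e : K) : mdist x y <= e -> mdist y z <= e -> mdist x z <= e.
Proof. by move=> xy yz; rewrite (le_trans (um x z y)) // ge_max xy yz. Qed.

(** The two longest sides of a triangle are equal. *)
Lemma ultra_isosceles x y z : mdist x y != mdist y z ->
  mdist x z = Num.max (mdist x y) (mdist y z).
Proof.
move=> ne; apply/eqP; rewrite eq_le um /= ge_max.
move: ne; case: (ltgtP (mdist x y) (mdist y z)) => // [xy|yz] _.
  have := um y z x; rewrite le_max (metric_sym y x) leNgt xy /= => yz.
  by rewrite yz (le_trans (ltW xy)).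
have := um x y z; rewrite le_max (metric_sym z y) orbC leNgt yz /= => xy.
by rewrite xy (le_trans (ltW yz)).
Qed.

(** Distances from [x] to a set are determined by a nearest point [a] of that set;
    this is what makes one-point extensions of isometries possible. *)
Lemma ultra_nearest x a a' : mdist x a <= mdist x a' ->
  mdist x a' = Num.max (mdist x a) (mdist a a').
Proof.
move=> le_a; have [aa'|/ultra_isosceles//] := eqVneq (mdist x a) (mdist a a').
apply/eqP; rewrite eq_le -aa' maxxx le_a andbT.
by apply: (ultra_le (y := a)); rewrite ?aa'.
Qed.

Lemma us_closed (S : set K) (D : set X) x : urysohn_subset S D ->
  (forall e, 0 < e -> exists2 y, D y & mdist x y < e) -> D x.
Proof.
move=> uD near_x.
have /choice[v vP] : forall n, exists y, D y /\ mdist x y < n.+1%:R^-1.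
  by move=> n; have [|y Dy xy] := near_x n.+1%:R^-1; [rewrite invr_gt0|exists y].
have vx m n : (m <= n)%N -> mdist x (v n) <= m.+1%:R^-1.
  move=> mn; apply/ltW/(lt_le_trans (proj2 (vP n))).
  by rewrite lef_pV2 ?posrE // ler_nat.
have [n|m n mn|l Dl vl] := us_complete uD (v := v).
- by case: (vP n).
- by apply: (@ultra_le _ x); rewrite ?(metric_sym _ x); exact: vx.
suff -> : x = l by [].
apply/mdist_positivity/eqP; rewrite eq_le mdist_ge0 andbT.
apply/ler_addgt0Pr => e e0; rewrite add0r.
have [N _ Ne] := near_infty_natSinv_lt (PosNum e0).
apply: le_trans (ltW (Ne N (leqnn N))).
exact: ultra_le (vx N N _) (vl N).
Qed.

End ultrametric_facts.

(** * Petals *)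

Section petal_facts.
Variables (K : realType) (R : set K) (X : metricType K) (Pi : set K -> set X).
Hypotheses (um : ultrametric X) (petal : is_petal R Pi).
Implicit Types (S T : set K).

Lemma petal_urysohn S : TEN R S -> urysohn_subset S (Pi S).
Proof.
by case: petal => + _ _ _ SR => /(_ S SR) [U [uU]]; exact: urysohn_universal_subset.
Qed.

Lemma petal_setI S T x : TEN R S -> TEN R T -> Pi S x -> Pi T x -> Pi (S `&` T) x.
Proof. by case: petal => _ _ PI _ SR TR Sx Tx; rewrite -PI. Qed.

Lemma petal_mono S T : TEN R S -> TEN R T -> S `<=` T -> Pi S `<=` Pi T.
Proof.
case: petal => _ _ PI _ SR TR /setIidPl ST x.
by rewrite -{1}ST -PI // => -[].
Qed.

(** The axiom on distances gives the infimum.  It is positive because petals are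
    complete, and attained because the distances belong to [T], which has
    finitely many elements above any positive number. *)
Lemma petal_nearest S T x : TEN R S -> TEN R T -> S `<=` T ->
  Pi T x -> ~ Pi S x ->
  exists c, [/\ Pi S c, 0 < mdist x c, T (mdist x c), ~ S (mdist x c) &
    forall c', Pi S c' -> mdist x c <= mdist x c'].
Proof.
move=> SR TR ST Tx Sx; set E := [set mdist x c | c in Pi S].
have uS := petal_urysohn SR; have uT := petal_urysohn TR.
have [u Su _] := us_dense uS.
have E0 : E !=set0 by exists (mdist x (u 0)), (u 0).
have lbE : lbound E 0 by move=> _ [c _ <-]; exact: mdist_ge0.
have infE : has_inf E by split=> //; exists 0.
have ET : E `<=` T.
  by move=> _ [c Sc <-]; apply: (us_valued uT) => //; exact: petal_mono Sc.
have rho0 : inf E != 0.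
  apply/eqP => rho0; apply: Sx; apply: (us_closed um uS) => e e0.
  have [_ [c Sc <-]] := inf_adherent e0 infE.
  by rewrite rho0 add0r; exists c.
have [TSrho|/eqP] : ((T `\` S) `|` [set 0]) (inf E); last by rewrite (negPf rho0).
  by case: petal => _ _ _; apply.
have rhopos : 0 < inf E by rewrite lt_neqAle eq_sym rho0 lb_le_inf.
have rhoE t : E t -> inf E <= t by apply: ge_inf; exists 0.
have fE : finite_set E.
  case: TR => Tt _ _.
  apply: sub_finite_set (tenuous_finite_ge Tt rhopos) => t Et.
  by split; [exact: ET|exact: rhoE].
have [_ [c Sc <-] cmin] := finite_set_argmin id fE E0.
have xc : mdist x c = inf E.
  by apply/eqP; rewrite eq_le rhoE ?andbT; [exact: lb_le_inf|exists c].
exists c; rewrite xc; case: TSrho => Trho Srho; split => // c' Sc'.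
by apply: rhoE; exists c'.
Qed.

End petal_facts.

(** * Finite enlargements of [S] and the skeleton of a petal *)

Definition finite_over (K : realType) (R S T : set K) : Prop :=
  [/\ TEN R T, S `<=` T & finite_set (T `\` S)].

Section finite_over_facts.
Variables (K : realType) (R S : set K).
Hypothesis SR : TEN R S.
Implicit Types (T I : set K).

Lemma finite_over_refl : finite_over R S S.
Proof. by split=> //; rewrite setDv. Qed.

Lemma finite_over_sub T I : finite_over R S T -> S `<=` I -> I `<=` T ->
  finite_over R S I.
Proof.
move=> [TR ST fT] SI IT; split=> //; last by apply: sub_finite_set fT; exact: setSD.
by apply: TEN_sub TR IT _; apply: SI; case: SR.
Qed.

Lemma finite_over_setI T I : finite_over R S T -> finite_over R S I ->
  finite_over R S (T `&` I).
Proof.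
move=> To [_ SI _]; apply: (finite_over_sub To); last exact: subIsetl.
by rewrite subsetI; split=> //; case: To.
Qed.

Lemma finite_over_remove T t : finite_over R S T -> ~ S t ->
  finite_over R S (T `\ t).
Proof.
move=> To St; apply: (finite_over_sub To); last exact: subDsetl.
by move=> s Ss; split; [case: To => _ + _; apply|move=> st; rewrite st in Ss].
Qed.

End finite_over_facts.

Definition petal_skeleton (K : realType) (R : set K) (X : Type)
    (Pi : set K -> set X) (S T : set K) : set X :=
  [set z | exists I, [/\ finite_over R S I, I `<=` T, I <> T & Pi I z]].

(** Let a partial isometry [g] be defined on [A] and on finitely many further
    points [F], and let [x] be a new point with nearest point [a].  An image of
    [x] has to lie on the sphere of radius [d x a] around [g a], away from the
    open balls of that radius around the points of [g A] and [g F].  If no point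
    of [A] lies on the corresponding sphere around [a], only the finitely many
    points of [g F], and [g a], forbid anything; this is the last clause. *)
Definition spared_nearest (K : realType) (X : metricType K) (D A : set X) : Prop :=
  forall (F : set X) (x : X), finite_set F -> F `<=` D -> D x -> ~ A x -> ~ F x ->
  exists a, [/\ (A `|` F) a, 0 < mdist x a,
    forall a', (A `|` F) a' -> mdist x a <= mdist x a' &
    forall a', A a' -> mdist a a' <> mdist x a].

Section skeleton.
Variables (K : realType) (R : set K) (X : metricType K) (Pi : set K -> set X).
Variables (S T : set K).
Hypotheses (um : ultrametric X) (petal : is_petal R Pi).
Hypotheses (SR : TEN R S) (To : finite_over R S T).
Local Notation skel := (petal_skeleton R Pi S T).

Let TR : TEN R T. Proof. by case: To. Qed.

Lemma skeleton_remove z : skel z -> exists2 t, (T `\` S) t & Pi (T `\ t) z.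
Proof.
move=> [I [Io IT neIT Iz]]; have [IR SI _] := Io.
have [t [Tt It]] : (T `\` I) !=set0.
  by apply/set0P/eqP; rewrite setD_eq0 => TI; apply: neIT; apply/seteqP.
have St : ~ S t by move=> /SI.
exists t => //.
have [TtR _ _] := finite_over_remove SR To St.
apply: (petal_mono petal IR TtR _ Iz) => s Is.
by split; [exact: IT|move=> st; rewrite st in Is].
Qed.

Lemma skeleton_sub z : skel z -> Pi T z.
Proof. by move=> [I [[IR _ _] IT _ Iz]]; exact: (petal_mono petal IR TR IT Iz). Qed.

Lemma remove_skeleton t z : T t -> ~ S t -> Pi (T `\ t) z -> skel z.
Proof.
move=> Tt St Tz; exists (T `\ t); split=> //.
- exact: finite_over_remove.
- by move=> TE; move: Tt; rewrite -TE => -[_]; apply.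
Qed.

(** Since [T] and [T \ {t}] differ only by [t], the distance axiom leaves a
    single value. *)
Lemma dist_remove x t : T t -> ~ S t -> Pi T x -> ~ Pi (T `\ t) x ->
  exists c, [/\ Pi (T `\ t) c, 0 < t, mdist x c = t &
    forall c', Pi (T `\ t) c' -> t <= mdist x c'].
Proof.
move=> Tt St Tx nTx; have [TtR _ _] := finite_over_remove SR To St.
have [c [Tc xc0 Txc nTxc cmin]] :=
  petal_nearest um petal TtR TR (@subDsetl _ _ _) Tx nTx.
have xcE : mdist x c = t by apply: contrapT => ne; apply: nTxc.
by rewrite xcE in xc0 cmin; exists c.
Qed.

(** With [r] the least element of [T \ S], points outside the skeleton are at
    distance at least [r] from it.  If [F] has a point closer to [x] than [r],
    the closest such point lies outside the skeleton and the claim is clear.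
    Otherwise take [c] nearest to [x] in [Pi (T \ {r})].  A point [a'] of the
    skeleton with [d c a' = r] does not lie in [Pi (T \ {r})], where [r] is no
    distance; so it lies in some [Pi (T \ {t})] with [t > r], and then
    [d x a' <= r < t] contradicts [dist_remove]. *)
Lemma skeleton_spared : S <> T -> spared_nearest (Pi T) skel.
Proof.
move=> neST F x fF FT Tx nx nFx.
have TS0 : (T `\` S) !=set0.
  apply/set0P/eqP; rewrite setD_eq0 => TS; apply: neST.
  by apply/seteqP; split=> //; case: To.
have [r [Tr Sr] rmin] : exists2 r, (T `\` S) r & forall t, (T `\` S) t -> r <= t.
  by case: To => _ _ fT; exact: finite_set_argmin id fT TS0.
have far z a t : Pi T z -> ~ skel z -> (T `\` S) t -> Pi (T `\ t) a -> t <= mdist z a.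
  move=> Tz nz [Tt St] Ta.
  have [|c [_ _ _]] := dist_remove Tt St Tz; last by apply.
  by move=> /(remove_skeleton Tt St).
have farr z a : Pi T z -> ~ skel z -> skel a -> r <= mdist z a.
  move=> Tz nz /skeleton_remove[t TSt Ta].
  by apply: le_trans (rmin t TSt) _; exact: far Ta.
have [|c [Tc r0 xc _]] := dist_remove Tr Sr Tx.
  by move=> /(remove_skeleton Tr Sr).
have skc : skel c by exact: remove_skeleton Tc.
have [[f [Ff fr]]|noF] := pselect (exists f, F f /\ mdist x f < r).
  have [|m Fm mmin] := finite_set_argmin (fun f => mdist x f) fF; first by exists f.
  have mr : mdist x m < r by apply: le_lt_trans fr; exact: mmin.
  exists m; split=> [||a' [ska'|Fa']|a' ska' ma'].
  - by right.
  - by rewrite mdist_gt0; apply/eqP => xm; apply: nFx; rewrite xm.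
  - by rewrite (le_trans (ltW mr)) // farr.
  - exact: mmin.
  - have nm : ~ skel m by move=> /(farr x m Tx nx); rewrite leNgt mr.
    by have := farr m a' (FT _ Fm) nm ska'; rewrite ma' leNgt mr.
exists c; rewrite xc; split=> [||a' [ska'|Fa']|a' ska' ca'] //.
- by left.
- exact: farr.
- by rewrite leNgt; apply/negP => a'r; apply: noF; exists a'.
have [t TSt Ta'] := skeleton_remove ska'.
have [tr|/eqP tr] := eqVneq t r.
  have [TrR _ _] := finite_over_remove SR To Sr.
  have := us_valued (petal_urysohn petal TrR) Tc; rewrite -tr in Tc *.
  by move=> /(_ a' Ta'); rewrite ca' -tr => -[_]; apply.
have /far/(_ Ta') := TSt => /(_ x Tx nx).
have xa' : mdist x a' <= r by apply: (ultra_le um (y := c)); rewrite ?xc ?ca'.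
move=> /le_trans/(_ xa') le_tr; apply: tr; apply/eqP.
by rewrite eq_le le_tr rmin.
Qed.

End skeleton.

(** * Partial isometries and back-and-forth *)

Section partial_isometries.
Variables (K : realType).

(** Partial isometries are represented by their graphs, which makes inverses,
    unions of chains and closures immediate. *)
Definition iso_rel (X Y : metricType K) (G : set (X * Y)) : Prop :=
  forall p q, G p -> G q -> mdist p.1 q.1 = mdist p.2 q.2.

Definition flip_rel (X Y : Type) (G : set (X * Y)) : set (Y * X) :=
  [set p | G (p.2, p.1)].

Definition carries (X Y : Type) (G : set (X * Y)) (A : set X) (B : set Y) : Prop :=
  (forall x, A x -> exists2 y, B y & G (x, y)) /\
  (forall y, B y -> exists2 x, A x & G (x, y)).

Definition rel_closure (X Y : metricType K) (G : set (X * Y)) : set (X * Y) :=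
  [set p | forall e, 0 < e ->
    exists2 q, G q & mdist p.1 q.1 < e /\ mdist p.2 q.2 < e].

Lemma iso_rel_flip (X Y : metricType K) (G : set (X * Y)) :
  iso_rel G -> iso_rel (flip_rel G).
Proof. by move=> iG p q Gp Gq; have := iG _ _ Gp Gq. Qed.

Lemma flip_relK (X Y : Type) (G : set (X * Y)) : flip_rel (flip_rel G) = G.
Proof. by apply/seteqP; split=> -[]. Qed.

Lemma iso_rel_fun (X Y : metricType K) (G : set (X * Y)) x y y' :
  iso_rel G -> G (x, y) -> G (x, y') -> y = y'.
Proof.
move=> iG Gy Gy'; apply: mdist_positivity.
by have /= <- := iG _ _ Gy Gy'; rewrite mdistxx.
Qed.

Lemma flip_rel_closure (X Y : metricType K) (G : set (X * Y)) x y :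
  rel_closure G (x, y) -> rel_closure (flip_rel G) (y, x).
Proof.
by move=> Gxy e e0; have [[x' y'] Gq [/= xx yy]] := Gxy e e0; exists (y', x').
Qed.

Lemma iso_rel_closure (X Y : metricType K) (G : set (X * Y)) :
  ultrametric X -> ultrametric Y -> iso_rel G -> iso_rel (rel_closure G).
Proof.
suff le_closure (X' Y' : metricType K) (H : set (X' * Y')) :
    ultrametric X' -> ultrametric Y' -> iso_rel H ->
    forall p q, rel_closure H p -> rel_closure H q ->
    mdist p.2 q.2 <= mdist p.1 q.1.
  move=> umX umY iG [x y] [x' y'] Gp Gq; apply/eqP; rewrite eq_le.
  rewrite (le_closure _ _ G) ?andbT //.
  apply: (le_closure _ _ (flip_rel G) umY umX _ (y, x) (y', x')).
  - exact: iso_rel_flip.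
  - exact: flip_rel_closure.
  - exact: flip_rel_closure.
move=> umX umY iH p q Hp Hq; apply/ler_addgt0Pr => e e0.
have [p' Hp' [/ltW px /ltW py]] := Hp e e0.
have [q' Hq' [/ltW qx /ltW qy]] := Hq e e0.
rewrite metric_sym in qy; rewrite metric_sym in px.
have le_e : e <= mdist p.1 q.1 + e by rewrite lerDr mdist_ge0.
apply: (ultra_le umY (y := q'.2)); last exact: le_trans le_e.
apply: (ultra_le umY (y := p'.2)); first exact: le_trans le_e.
rewrite -iH //; apply: (ultra_le umX (y := q.1)); last exact: le_trans le_e.
apply: (ultra_le umX (y := p.1)); first exact: le_trans le_e.
by rewrite lerDl ltW.
Qed.

(** If the points of the domain near [x] have images in the complete set [E], these
    images form a Cauchy sequence, whose limit is related to [x]. *)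
Lemma rel_closure_total (X Y : metricType K) (S : set K) (G : set (X * Y))
    (E : set Y) (x : X) :
  ultrametric X -> ultrametric Y -> iso_rel G -> urysohn_subset S E ->
  (forall e, 0 < e -> exists p, [/\ G p, E p.2 & mdist x p.1 < e]) ->
  exists2 y, E y & rel_closure G (x, y).
Proof.
move=> umX umY iG uE near_x.
have /choice[v vP] : forall n, exists p, [/\ G p, E p.2 & mdist x p.1 < n.+1%:R^-1].
  by move=> n; apply: near_x; rewrite invr_gt0.
have vx m n : (m <= n)%N -> mdist x (v n).1 <= m.+1%:R^-1.
  move=> mn; have [_ _ xv] := vP n; apply/ltW/(lt_le_trans xv).
  by rewrite lef_pV2 ?posrE // ler_nat.
have [n|m n mn|y Ey vy] := us_complete uE (v := fun n => (v n).2).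
- by have [] := vP n.
- have [Gm _ _] := vP m; have [Gn _ _] := vP n.
  rewrite -iG //; apply: (ultra_le umX (y := x));
    by rewrite ?(metric_sym _ x); exact: vx.
exists y => // e e0; have [N _ Ne] := near_infty_natSinv_lt (PosNum e0).
have [GN _ _] := vP N; exists (v N) => //=.
rewrite (metric_sym y); split; apply: le_lt_trans (Ne N (leqnn N)).
- exact: vx.
- exact: vy.
Qed.

Definition finite_extension (X Y : metricType K) (D : set X) (E : set Y)
    (H0 H : set (X * Y)) : Prop :=
  [/\ H0 `<=` H, forall p, H p -> D p.1 /\ E p.2, iso_rel H &
      finite_set (H `\` H0)].

Lemma finite_extension_flip (X Y : metricType K) (D : set X) (E : set Y)
    (H0 H : set (X * Y)) :
  finite_extension D E H0 H -> finite_extension E D (flip_rel H0) (flip_rel H).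
Proof.
move=> [H0H HDE iH fH]; split.
- by move=> [y x] /H0H.
- by move=> [y x] /HDE [].
- exact: iso_rel_flip.
- apply: (@sub_finite_set _ _ ((fun p => (p.2, p.1)) @` (H `\` H0))).
    by move=> [y x] Hp; exists (x, y).
  exact: finite_image.
Qed.

(** The image [y] of [x] is put at distance [d x a] from the image [b] of a nearest
    point [a], far from the images of the finitely many points outside [H0].
    Points of [H0] are then at the right distance because they avoid the sphere
    around [b], so that the isosceles law determines their distance to [y]. *)
Lemma forth_step (X Y : metricType K) (T : set K) (D : set X) (E : set Y)
    (H0 H : set (X * Y)) (x : X) :
  ultrametric X -> ultrametric Y -> urysohn_subset T D -> urysohn_subset T E ->
  spared_nearest D [set z | exists w, H0 (z, w)] ->
  finite_extension D E H0 H -> D x ->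
  exists H', [/\ finite_extension D E H0 H', H `<=` H' & exists y, H' (x, y)].
Proof.
move=> umX umY uD uE spare [H0H HDE iH fH] Dx.
have [Hx|nHx] := pselect (exists y, H (x, y)); first by exists H; split; [split| |].
pose F := fst @` (H `\` H0).
have domH z w : H (z, w) -> ([set z | exists w, H0 (z, w)] `|` F) z.
  move=> Hzw; have [H0zw|nH0] := pselect (H0 (z, w)); first by left; exists w.
  by right; exists (z, w).
have [|||||a [aA xa0 amin aspare]] := spare F x.
- exact: finite_image.
- by move=> _ [p [Hp _] <-]; case: (HDE p Hp).
- by [].
- by move=> [w /H0H Hxw]; apply: nHx; exists w.
- by move=> [[z w] [Hp _] /= zx]; apply: nHx; exists w; rewrite -zx.
have [b Hab] : exists b, H (a, b).
  by case: aA => [[b /H0H]|[[z b] [Hp _] /= <-]]; exists b.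
have [Da Eb] := HDE _ Hab.
have [|||||y [Ey yb yF]] := us_spread uE (A := b |` (snd @` (H `\` H0))) (b := b)
    (r := mdist x a).
- by rewrite finite_setU; split; [exact: finite_set1|exact: finite_image].
- by move=> _ [->//|[p [Hp _] <-]]; case: (HDE p Hp).
- by left.
- by [].
- exact: (us_valued uD).
have new q : H q -> mdist x q.1 = mdist y q.2.
  case: q => z w Hzw /=; have az := iH _ _ Hab Hzw; rewrite /= in az.
  rewrite (ultra_nearest umX (amin _ (domH _ _ Hzw))) az -yb; symmetry.
  have [H0zw|nH0] := pselect (H0 (z, w)).
    apply: ultra_isosceles => //; rewrite yb -az; apply/eqP => xa.
    by apply: (aspare z); [exists w|].
  by apply: ultra_nearest => //; rewrite yb; apply: yF; right; exists (z, w).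
exists (H `|` [set (x, y)]); split; last by exists y; right.
- split.
  + by move=> p /H0H; left.
  + by move=> p [/HDE//|->].
  + move=> p q [Hp|->] [Hq|->] /=; rewrite ?mdistxx //; first exact: iH.
    * by rewrite metric_sym new // metric_sym.
    * exact: new.
  + rewrite setDUl finite_setU; split=> //.
    by apply: finite_setD; exact: finite_set1.
- by move=> p; left.
Qed.

Lemma back_and_forth (X Y : metricType K) (T : set K) (D : set X) (E : set Y)
    (H0 : set (X * Y)) :
  ultrametric X -> ultrametric Y -> urysohn_subset T D -> urysohn_subset T E ->
  spared_nearest D [set z | exists w, H0 (z, w)] ->
  spared_nearest E [set w | exists z, H0 (z, w)] ->
  iso_rel H0 -> (forall p, H0 p -> D p.1 /\ E p.2) ->
  exists H, [/\ iso_rel H, H0 `<=` H, forall p, H p -> D p.1 /\ E p.2 &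
    carries H D E].
Proof.
move=> umX umY uD uE spX spY iH0 H0DE.
have [u Du ud] := us_dense uD; have [v Ev vd] := us_dense uE.
pose fext := finite_extension D E H0.
have step (n : nat) (H : set (X * Y)) : fext H -> exists H', [/\ fext H', H `<=` H',
    exists y, H' (u n, y) & exists x, H' (x, v n)].
  move=> fH; have [H1 [fH1 HH1 [y H1y]]] := forth_step umX umY uD uE spX fH (Du n).
  have [H2 [fH2 H12 [x H2x]]] :=
    forth_step umY umX uE uD spY (finite_extension_flip fH1) (Ev n).
  exists (flip_rel H2); split.
  - by have := finite_extension_flip fH2; rewrite flip_relK.
  - by move=> [z w] /HH1 H1zw; exact: (H12 (w, z)).
  - by exists y; exact: (H12 (y, u n)).
  - by exists x.
have /choice[g gP] : forall nH : nat * set (X * Y), exists H', fext nH.2 ->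
    [/\ fext H', nH.2 `<=` H', exists y, H' (u nH.1, y) & exists x, H' (x, v nH.1)].
  move=> [n H]; have [fH|nfH] := pselect (fext H); last by exists H.
  by have [H' H'P] := step n H fH; exists H'.
pose Hs := nat_rect (fun=> set (X * Y)) H0 (fun n H => g (n, H)).
have fHs n : fext (Hs n).
  elim: n => [|n IH]; first by split=> //; rewrite setDv.
  by case: (gP (n, Hs n) IH).
have HsS n : Hs n `<=` Hs n.+1 by case: (gP (n, Hs n) (fHs n)).
have Hsle m n : (m <= n)%N -> Hs m `<=` Hs n.
  by apply: (homo_leq (r := subset)) => // [A|B A C];
    [exact: subset_refl|exact: subset_trans].
pose L := \bigcup_n Hs n.
have iL : iso_rel L.
  move=> p q [m _ Hm] [n _ Hn]; have [_ _ iH _] := fHs (maxn m n).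
  by apply: iH; [apply: Hsle Hm; exact: leq_maxl|apply: Hsle Hn; exact: leq_maxr].
have LDE p : L p -> D p.1 /\ E p.2 by move=> [n _]; case: (fHs n) => _ + _ _; apply.
have Lu n : exists y, L (u n, y).
  by case: (gP (n, Hs n) (fHs n)) => _ _ [y Hy] _; exists y, n.+1.
have Lv n : exists x, L (x, v n).
  by case: (gP (n, Hs n) (fHs n)) => _ _ _ [x Hx]; exists x, n.+1.
(* Intersecting spares showing that [D] and [E] are closed. *)
exists (rel_closure L `&` [set p | D p.1 /\ E p.2]); split.
- by move=> p q [Lp _] [Lq _]; exact: (iso_rel_closure umX umY iL).
- move=> p H0p; split; last exact: H0DE.
  by move=> e e0; exists p; rewrite ?mdistxx //; exists 0%N.
- by move=> p [].
split=> [x Dx|y Ey].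
- have [e e0|y Ey Lxy] := rel_closure_total (E := E) (x := x) umX umY iL uE.
    have [n xn] := ud x e Dx e0; have [y Ly] := Lu n.
    by exists (u n, y); split=> //; case: (LDE _ Ly).
  by exists y.
- have [e e0|x Dx Lyx] :=
    rel_closure_total (E := D) (x := y) umY umX (iso_rel_flip iL) uD.
    have [n yn] := vd y e Ey e0; have [x Lx] := Lv n.
    by exists (v n, x); split=> //; case: (LDE _ Lx).
  by exists x => //; split=> //; have := flip_rel_closure Lyx; rewrite flip_relK.
Qed.

End partial_isometries.

(** * Extending to one more petal *)

(** Starting the maximality argument above [G0] relieves [P] of the empty chain. *)
Lemma Zorn_above (T : Type) (P : set T -> Prop) (G0 : set T) : P G0 ->
  (forall F : set (set T), F !=set0 -> F `<=` P -> total_on F subset ->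
    P (\bigcup_(G in F) G)) ->
  exists G, [/\ P G, G0 `<=` G & forall G', P G' -> G `<=` G' -> G' `<=` G].
Proof.
move=> PG0 chain.
have [F FP Ftot|A [PA Amax]] := @Zorn_bigcup T (fun G => P (G0 `|` G)).
  have [->|/set0P [Z FZ]] := eqVneq F set0; first by rewrite bigcup_set0 setU0.
  have -> : G0 `|` \bigcup_(G in F) G = \bigcup_(G in setU G0 @` F) G.
    apply/seteqP; split=> t.
    - by move=> [G0t|[G FG Gt]]; [exists (G0 `|` Z); [exists Z|left]|
        exists (G0 `|` G); [exists G|right]].
    - by move=> [_ [G FG <-] [G0t|Gt]]; [left|right; exists G].
  apply: chain => [|_ [G /FP PG <-]//|_ _ [G1 FG1 <-] [G2 FG2 <-]].
    by exists (G0 `|` Z), Z.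
  by have [|] := Ftot _ _ FG1 FG2; [left|right]; exact: setUS.
exists (G0 `|` A); split=> // G' PG' sub; apply: contrapT => nsub.
have G0G' : G0 `<=` G' by move=> t G0t; apply: sub; left.
apply: (Amax G'); last by rewrite setUidr.
split; first by move=> t At; apply: sub; right.
by move=> G'A; apply: nsub => t /G'A At; right.
Qed.

Section extension.
Variables (K : realType) (R : set K) (X Y : metricType K).
Variables (PiX : set K -> set X) (PiY : set K -> set Y) (S : set K).
Hypotheses (umX : ultrametric X) (umY : ultrametric Y).
Hypotheses (petalX : is_petal R PiX) (petalY : is_petal R PiY) (SR : TEN R S).
Implicit Types (G : set (X * Y)) (T I : set K).

(** The petals carried by [G] are quantified inside the property, not recorded as
    part of the data; being carried is monotone in [G], so the property passes to
    unions of chains. *)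
Definition petal_compatible G : Prop :=
  iso_rel G /\ forall p, G p -> exists I, [/\ finite_over R S I, PiX I p.1, PiY I p.2 &
    forall J, finite_over R S J -> J `<=` I -> carries G (PiX J) (PiY J)].

Lemma carries_sub G G' (A : set X) (B : set Y) :
  G `<=` G' -> carries G A B -> carries G' A B.
Proof.
move=> GG' [AB BA]; split=> [x /AB[y By /GG']|y /BA[x Ax /GG']].
- by exists y.
- by exists x.
Qed.

Lemma carries_flip (A : set X) (B : set Y) G :
  carries G A B -> carries (flip_rel G) B A.
Proof. by move=> [AB BA]; split. Qed.

Lemma carriesl G A B x y : iso_rel G -> carries G A B -> G (x, y) -> A x -> B y.
Proof.
by move=> iG [AB _] Gxy /AB[y' By' Gxy']; rewrite (iso_rel_fun iG Gxy Gxy').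
Qed.

Lemma compatible_bigcup (F : set (set (X * Y))) : F `<=` petal_compatible ->
  total_on F subset -> petal_compatible (\bigcup_(G in F) G).
Proof.
move=> FP Ftot; split=> [p q [G1 F1 G1p] [G2 F2 G2q]|p [G FG Gp]].
  have [G12|G21] := Ftot _ _ F1 F2.
  - by have [iG _] := FP _ F2; apply: iG => //; exact: G12.
  - by have [iG _] := FP _ F1; apply: iG => //; exact: G21.
have [_ /(_ p Gp) [I [Io Ix Iy IG]]] := FP _ FG.
exists I; split=> // J Jo JI; apply: carries_sub (IG J Jo JI).
exact: bigcup_sup.
Qed.

(** The back-and-forth extends the part of [G] over the skeleton of [T] to an
    isometry [H] of the whole petal, and [G `|` H] is again compatible because
    [d(x, z)] is the largest of three distances that both relations preserve; so
    maximality puts [H] inside [G]. *)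
Lemma compatible_carries G T : petal_compatible G -> finite_over R S T ->
  carries G (PiX S) (PiY S) ->
  (forall G', petal_compatible G' -> G `<=` G' -> G' `<=` G) ->
  (forall J, finite_over R S J -> J `<=` T -> J <> T -> carries G (PiX J) (PiY J)) ->
  carries G (PiX T) (PiY T).
Proof.
move=> [iG GI] To GS Gmax GJ; apply: contrapT => nGT.
have TR : TEN R T by case: To.
have neST : S <> T by move=> ST; apply: nGT; rewrite -ST.
pose skX := petal_skeleton R PiX S T; pose skY := petal_skeleton R PiY S T.
pose H0 := G `&` [set p | skX p.1 /\ skY p.2].
have H0J J p : finite_over R S J -> J `<=` T -> J <> T -> G p -> PiX J p.1 -> H0 p.
  move=> Jo JT neJT Gp Jx; split=> //; split; exists J; split=> //.
  by case: p Gp Jx => x y Gp Jx; exact: carriesl (GJ J Jo JT neJT) Gp Jx.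
have dom0 : [set z | exists w, H0 (z, w)] = skX.
  apply/seteqP; split=> [z [w [_ []]]//|z [J [Jo JT neJT Jz]]].
  have [w Jw Gzw] := proj1 (GJ J Jo JT neJT) z Jz.
  by exists w; exact: H0J Gzw Jz.
have ran0 : [set w | exists z, H0 (z, w)] = skY.
  apply/seteqP; split=> [w [z [_ []]]//|w [J [Jo JT neJT Jw]]].
  have [z Jz Gzw] := proj2 (GJ J Jo JT neJT) w Jw.
  by exists z; exact: H0J Gzw Jz.
have [||||||H [iH H0H HT Hcar]] := back_and_forth (D := PiX T) (E := PiY T) (T := T)
  (H0 := H0) umX umY.
- exact: (petal_urysohn petalX TR).
- exact: (petal_urysohn petalY TR).
- by rewrite dom0; exact: skeleton_spared.
- by rewrite ran0; exact: skeleton_spared.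
- by move=> p q [Gp _] [Gq _]; exact: iG.
- move=> p [_ [skp1 skp2]]; split.
    exact: (skeleton_sub petalX To skp1).
  exact: (skeleton_sub petalY To skp2).
have cross p q : H p -> G q -> mdist p.1 q.1 = mdist p.2 q.2.
  move: p q => [x y] [z w] Hxy Gzw.
  have [I [Io Iz Iw IG]] := GI _ Gzw; have IR : TEN R I by case: Io.
  have TIo := finite_over_setI SR To Io; have TIR : TEN R (T `&` I) by case: TIo.
  have neTI : T `&` I <> T.
    by move=> /setIidPl TI; apply: nGT; apply: IG.
  have TIcar : carries G (PiX (T `&` I)) (PiY (T `&` I)).
    by apply: GJ => //; exact: subIsetl.
  have H0TI q : G q -> PiX (T `&` I) q.1 -> H0 q.
    by apply: H0J => //; exact: subIsetl.
  have [Tx Ty] := HT _ Hxy; rewrite /= in Tx Ty Iz Iw.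
  have [TIx|nTIx] := pselect (PiX (T `&` I) x).
    have [y' TIy' Gxy'] := proj1 TIcar x TIx.
    have Hxy' := H0H _ (H0TI _ Gxy' TIx).
    by rewrite (iso_rel_fun iH Hxy Hxy') -(iG _ _ Gxy' Gzw).
  have [TIz|nTIz] := pselect (PiX (T `&` I) z).
    exact: (iH _ _ Hxy (H0H _ (H0TI _ Gzw TIz))).
  have [p [TIp xp0 Txp nxp _]] :=
    petal_nearest umX petalX TIR TR (@subIsetl _ _ _) Tx nTIx.
  have [q [TIq zq0 Izq nzq _]] :=
    petal_nearest umX petalX TIR IR (@subIsetr _ _ _) Iz nTIz.
  have [p' TIp' Gp] := proj1 TIcar p TIp; have [q' TIq' Gq] := proj1 TIcar q TIq.
  have TIpq := us_valued (petal_urysohn petalX TIR) TIp TIq.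
  have xpE : mdist x p = mdist y p' := iH _ _ Hxy (H0H _ (H0TI _ Gp TIp)).
  have zqE : mdist z q = mdist w q' := iG _ _ Gzw Gq.
  have pqE : mdist p q = mdist p' q' := iG _ _ Gp Gq.
  (* The three lengths of the path x, p, q, z lie in disjoint sets. *)
  have ne_pz : mdist p q != mdist q z.
    by apply/eqP; rewrite (metric_sym q) => pqz; apply: nzq; rewrite -pqz.
  have ne_xz : mdist x p != mdist p z.
    rewrite (ultra_isosceles umX ne_pz); case: leP => _; apply/eqP => xpz.
      by rewrite metric_sym in Izq; apply: nxp; rewrite xpz in Txp *; split.
    by apply: nxp; rewrite xpz.
  have pzE : mdist p z = mdist p' w.
    rewrite (ultra_isosceles umX ne_pz) pqE (metric_sym q z) zqE (metric_sym w q').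
    rewrite pqE (metric_sym q z) zqE (metric_sym w q') in ne_pz.
    by rewrite (ultra_isosceles umY ne_pz).
  have ne_yw : mdist y p' != mdist p' w by rewrite -xpE -pzE.
  by rewrite /= (ultra_isosceles umX ne_xz) (ultra_isosceles umY ne_yw) xpE pzE.
have GHP : petal_compatible (G `|` H).
  split=> [p q [Gp|Hp] [Gq|Hq]|p [Gp|Hp]].
  - exact: iG.
  - by rewrite metric_sym cross // metric_sym.
  - exact: cross.
  - exact: iH.
  - have [I [Io Ix Iy IG]] := GI _ Gp; exists I; split=> // J Jo JI.
    by apply: carries_sub (IG J Jo JI); exact: subsetUl.
  - have [Tx Ty] := HT p Hp; exists T; split=> // J Jo JT.
    have [->|/eqP neJT] := eqVneq J T.
      by apply: carries_sub Hcar; exact: subsetUr.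
    by apply: carries_sub (GJ J Jo JT neJT); exact: subsetUl.
apply: nGT; apply: carries_sub Hcar => p Hp.
by apply: (Gmax _ GHP (@subsetUl _ _ _)); right.
Qed.

End extension.

(** * Reaching the whole space *)

(** Induction on the number of elements of [T \ S]. *)
Lemma compatible_maximal_carries (K : realType) (R : set K) (X Y : metricType K)
    (PiX : set K -> set X) (PiY : set K -> set Y) (S : set K) (G : set (X * Y)) :
  ultrametric X -> ultrametric Y -> is_petal R PiX -> is_petal R PiY -> TEN R S ->
  petal_compatible R PiX PiY S G -> carries G (PiX S) (PiY S) ->
  (forall G', petal_compatible R PiX PiY S G' -> G `<=` G' -> G' `<=` G) ->
  forall T, finite_over R S T -> carries G (PiX T) (PiY T).
Proof.
move=> umX umY petalX petalY SR GP GS Gmax T.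
have [n] := ubnP (#|` fset_set (T `\` S)|)%fset; elim: n T => // n IH T Tn To.
apply: (compatible_carries umX umY petalX petalY SR GP To GS Gmax) => J Jo JT neJT.
rewrite ltnS in Tn; apply: IH => //; apply: leq_trans Tn; apply: fproper_ltn_card.
have [_ SJ fJ] := Jo; have [_ ST fT] := To.
rewrite fproperEneq; apply/andP; split; last first.
  by rewrite -fset_set_sub //; exact: setSD.
apply/eqP => /(fset_set_inj fJ fT) JTS; apply: neJT; apply/seteqP; split=> // t Tt.
have [/SJ//|St] := pselect (S t).
by have [] : (J `\` S) t by rewrite JTS.
Qed.

(** Take [T = S `|` {t in J | e <= t}]: a point of [Pi J] outside [Pi T] is at a
    distance in [J \ T] from it, hence smaller than [e]. *)
Lemma petal_approx (K : realType) (R : set K) (X : metricType K)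
    (Pi : set K -> set X) (S J : set K) (x : X) (e : K) :
  ultrametric X -> is_petal R Pi -> TEN R S -> TEN R J -> S `<=` J -> Pi J x ->
  0 < e -> exists T c, [/\ finite_over R S T, T `<=` J, Pi T c & mdist x c < e].
Proof.
move=> um petal SR JR SJ Jx e0; pose T := S `|` (J `&` [set t | e <= t]).
have TJ : T `<=` J by rewrite subUset; split=> //; exact: subIsetl.
have To : finite_over R S T.
  split; [|exact: subsetUl|].
    by apply: TEN_sub JR TJ _; left; case: SR.
  rewrite setDUl setDv set0U; apply: finite_setD.
  by case: JR => Jt _ _; exact: tenuous_finite_ge.
have [Tx|nTx] := pselect (Pi T x); first by exists T, x; rewrite mdistxx.
have [TR _ _] := To.
have [c [Tc _ Jxc nTxc _]] := petal_nearest um petal TR JR TJ Jx nTx.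
exists T, c; split=> //; rewrite ltNge; apply/negP => exc.
by apply: nTxc; right.
Qed.

(** The point [x] lies in a petal over some [J] containing [S].  The points that
    approximate it have images in the petal of [Y] over the same [J], which is
    complete; completeness of [Y] itself is not at hand. *)
Lemma closure_carries_total (K : realType) (R : set K) (X Y : metricType K)
    (PiX : set K -> set X) (PiY : set K -> set Y) (S : set K) (G : set (X * Y))
    (x : X) :
  ultrametric X -> ultrametric Y -> is_petal R PiX -> is_petal R PiY -> TEN R S ->
  iso_rel G -> (forall T, finite_over R S T -> carries G (PiX T) (PiY T)) ->
  exists y, rel_closure G (x, y).
Proof.
move=> umX umY petalX petalY SR iG GT.
have [J0 J0R J0x] : (\bigcup_(J in TEN R) PiX J) x by case: petalX => _ -> _ _.
have JR := TEN_setU SR J0R; set J := S `|` J0 in JR.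
have Jx : PiX J x by apply: (petal_mono petalX J0R JR _ J0x); exact: subsetUr.
have [e e0|y _ Gxy] :=
    rel_closure_total (x := x) umX umY iG (petal_urysohn petalY JR); last by exists y.
have [T [c [To TJ Tc xc]]] := petal_approx umX petalX SR JR (@subsetUl _ _ _) Jx e0.
have [y Ty Gcy] := proj1 (GT T To) c Tc; exists (c, y); split=> //.
by case: To => TR _ _; exact: (petal_mono petalY TR JR TJ).
Qed.

Theorem theorem3p3 (K : realType) (R : set K) (X Y : metricType K)
    (PiX : set K -> set X) (PiY : set K -> set Y) (S : set K) (f : X -> Y) :
  range_set R -> ~ countable R ->
  petaloid R X -> petaloid R Y ->
  is_petal R PiX -> is_petal R PiY ->
  TEN R S ->
  set_bij (PiX S) (PiY S) f -> isometric_on (PiX S) f ->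
  exists F : X -> Y,
    [/\ bijective F, isometric F & forall x, PiX S x -> F x = f x].
Proof.
move=> _ _ [umX _ _] [umY _ _] petalX petalY SR fbij fiso.
pose G0 := [set p : X * Y | PiX S p.1 /\ p.2 = f p.1].
have G0S : carries G0 (PiX S) (PiY S).
  split=> [x Sx|y Sy]; first by exists (f x) => //; exact: set_bij_homo fbij _ Sx.
  by have [x Sx <-] := set_bij_surj fbij Sy; exists x.
have G0P : petal_compatible R PiX PiY S G0.
  split=> [[x y] [z w] [/= Sx ->] [/= Sz ->]|[x y] [/= Sx ->]]; first by rewrite fiso.
  exists S; split=> //=; first exact: finite_over_refl.
    exact: set_bij_homo fbij _ Sx.
  move=> J [_ SJ _] JS; suff -> : J = S by [].
  exact/seteqP.
have [F _ FP Ftot|G [GP G0G Gmax]] := Zorn_above G0P.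
  exact: compatible_bigcup FP Ftot.
have GT := compatible_maximal_carries umX umY petalX petalY SR GP
  (carries_sub G0G G0S) Gmax.
have iG : iso_rel G by case: GP.
have iL := iso_rel_closure umX umY iG.
have /choice[F FG] : forall x, exists y, rel_closure G (x, y).
  by move=> x; exact: closure_carries_total GT.
have /choice[F' F'G] : forall y, exists x, rel_closure G (x, y).
  move=> y; have [|x Gyx] := closure_carries_total (G := flip_rel G) y
      umY umX petalY petalX SR (iso_rel_flip iG).
    by move=> T /GT; exact: carries_flip.
  by exists x; have := flip_rel_closure Gyx; rewrite flip_relK.
have Fiso : isometric F by move=> x z _ _; have := iL _ _ (FG x) (FG z).
exists F; split=> //.
- exists F' => [x|y].
  + apply: mdist_positivity.
    by have /= -> := iL _ _ (F'G (F x)) (FG x); rewrite mdistxx.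
  + exact: iso_rel_fun iL (FG (F' y)) (F'G y).
- move=> x Sx; apply: iso_rel_fun iL (FG x) _ => e e0.
  by exists (x, f x); rewrite ?mdistxx //; exact: G0G.
Qed.
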